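(* For $n\ge1$, $$\sum_{\pi\in\mathrm{PPF}(n)}x^{\mathrm{unl}(\pi)}y^{\mathrm{lel}(\pi)}=y\prod_{i=1}^{n-1}\big(xy+(i-1)x+n-1-i\big).$$
   Context: A parking function of length $n$ is a sequence $\pi=(\pi_1,\dots,\pi_n)$ of positive integers whose increasing rearrangement $b_1\le\dots\le b_n$ satisfies $b_i\le i$. It is prime if for every $1\le j\le n-1$ at least $j+1$ of the entries are $\le j$; $\mathrm{PPF}(n)$ is the set of prime parking functions of length $n$. Under the classical protocol (cars $1,\dots,n$ arrive in order, car $i$ parks in the first unoccupied spot among $\pi_i,\pi_i+1,\dots,n$), $\mathrm{unl}(\pi)$ is the number of cars not parking at their preferred spot. $\mathrm{lel}(\pi)=\#\{i:\pi_i=\pi_1\}$. *)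

(* Defs.v *)
From HB Require Import structures.
From mathcomp Require Import all_boot all_order all_algebra.

Set Implicit Arguments.
Unset Strict Implicit.
Unset Printing Implicit Defensive.

(* Preferences and spots are 1-based natural numbers; the i-th term of a
   sequence s is [nth 0 s i.-1]. *)

Definition is_pf (s : seq nat) : bool :=
  all (leq 1) s && all (fun i => nth 0 (sort leq s) i.-1 <= i) (iota 1 (size s)).

Definition is_ppf (s : seq nat) : bool :=
  is_pf s && all (fun j => j.+1 <= count (fun a => a <= j) s)
                 (iota 1 (size s).-1).

(* [None] when all of the spots a, a + 1, ..., n are occupied. *)
Definition first_free (n : nat) (occ : seq nat) (a : nat) : option nat :=
  ohead [seq t <- iota a (n.+1 - a) | t \notin occ].

Fixpoint park (n : nat) (occ s : seq nat) : seq (option nat) :=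
  if s is a :: s' then
    let o := first_free n occ a in
    o :: park n (if o is Some t then t :: occ else occ) s'
  else [::].

(* A car that fails to park counts as not parking at its preferred spot; this
   does not occur for parking functions. *)
Definition unl (s : seq nat) : nat :=
  count (fun p : option nat * nat => p.1 != Some p.2)
        (zip (park (size s) [::] s) s).

Definition lel (s : seq nat) : nat := count_mem (head 0 s) s.

Definition entries (n : nat) (p : n.-tuple 'I_n.+1) : seq nat :=
  [seq nat_of_ord a | a <- p].

(* The entries of a parking function of length n are at most n, so bounding
   them by n loses nothing: see [is_ppf_entries]. *)
Definition PPF (n : nat) : {set n.-tuple 'I_n.+1} :=
  [set p | is_ppf (entries p)].

Lemma is_pf_le (s : seq nat) : is_pf s -> all (fun a => a <= size s) s.
Proof.
case/andP=> _ /allP Hs; apply/allP=> a; rewrite -(mem_sort leq) => ain.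
have lt_i : index a (sort leq s) < size s by rewrite -(size_sort leq) index_mem.
have := Hs (index a (sort leq s)).+1.
rewrite mem_iota /= add1n ltnS lt_i nth_index // => /(_ isT) /leq_trans; exact.
Qed.

Lemma is_ppf_entries (s : seq nat) :
  is_ppf s -> exists2 p, p \in PPF (size s) & entries p = s.
Proof.
move=> Hs; have /andP[/is_pf_le/allP le_s _] := Hs.
have sz : size [seq inord a : 'I_(size s).+1 | a <- s] == size s.
  by rewrite size_map.
have E : entries (Tuple sz) = s.
  rewrite /entries /= -map_comp -[RHS]map_id; apply/eq_in_map=> a /le_s le_a.
  by rewrite /= inordK.
by exists (Tuple sz); rewrite ?inE E.
Qed.

(* Main.v *)
Require Import Defs.
From HB Require Import structures.
From mathcomp Require Import all_boot all_order all_algebra.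
From mathcomp Require Import zify ring.

Set Implicit Arguments.
Unset Strict Implicit.
Unset Printing Implicit Defensive.

Import Order.TTheory GRing.Theory Num.Theory.
Local Open Scope ring_scope.

(* Let m = n - 1 and read spots 1, ..., m as residues modulo m. Write P(i) for
   the number of cars preferring one of the first i spots, extended so that
   P(i + m) = P(i) + n. By the cycle lemma, the integer m P(i) - n i, which
   is periodic and injective modulo m, attains its minimum at exactly one
   residue, and shifting this residue to spot 1 gives the only prime parking
   function in the shift class of a word of length n over Z/m. In a prime
   parking function the first m cars fill spots 1, ..., m without passing m, so
   parking on a line and on a circle of m spots have the same unlucky cars.
   Since unl and lel become shift invariant on the circle, one may replace
   prime words by words starting with 0. Then a car arriving when i >= 1 spots
   are taken, spot 0 among them, contributes x y + (i - 1) x + (m - i). *)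

(** * Parking on a circle of [k.+1] spots and its rotation invariance *)

(* Junk value [a] when all spots of the circle are occupied. *)
Definition circ_free (k : nat) (C : {set 'I_k.+1}) (a : 'I_k.+1) : 'I_k.+1 :=
  if [pick j : 'I_k.+1 | (a + j \notin C) &&
      [forall i : 'I_k.+1, (i < j)%N ==> (a + i \in C)]]
  is Some j then a + j else a.

Fixpoint circ_unl (k : nat) (C : {set 'I_k.+1}) (s : seq 'I_k.+1) : nat :=
  if s is a :: s' then ((a \in C) + circ_unl (circ_free C a |: C) s')%N else 0%N.

Lemma circ_freeE (k : nat) (C : {set 'I_k.+1}) (a j : 'I_k.+1) :
  a + j \notin C -> (forall i : 'I_k.+1, (i < j)%N -> a + i \in C) ->
  circ_free C a = a + j.
Proof.
move=> jC ltC; rewrite /circ_free; case: pickP => [l /andP[lC /forallP ltlC]|].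
  congr (_ + _); apply: val_inj; case: (ltngtP l j) => // lt.
    by rewrite (ltC _ lt) in lC.
  by move: (ltlC j); rewrite lt (negbTE jC).
by move=> /(_ j); rewrite jC /= => /negP[]; apply/forallP=> i; apply/implyP/ltC.
Qed.

Lemma circ_free_notin (k : nat) (C : {set 'I_k.+1}) (a : 'I_k.+1) :
  (#|C| <= k)%N -> circ_free C a \notin C.
Proof.
move=> ltC; have [b bC] : exists b, b \notin C.
  apply/existsP; rewrite -negb_forall; apply/negP=> /forallP inC.
  have /subset_leq_card : setT \subset C by apply/subsetP=> b _; exact: inC.
  by rewrite cardsT card_ord ltnNge ltC.
have Pb : a + (b - a) \notin C by rewrite addrC subrK.
(* The displacement [j] is chosen minimal, so every spot passed on the way is occupied. *)
case: (@arg_minnP _ (b - a) (fun j => a + j \notin C) val Pb) => j jC minj.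
rewrite (@circ_freeE _ _ _ j) // => i lt_ij; apply: contraLR lt_ij.
by move=> /minj; rewrite -leqNgt.
Qed.

Lemma circ_free_shift (k : nat) (C : {set 'I_k.+1}) (a c : 'I_k.+1) :
  circ_free [set r + c | r in C] (a + c) = circ_free C a + c.
Proof.
have inE' r : (r + c \in [set r + c | r in C]) = (r \in C).
  exact: (mem_imset _ _ (addIr c)).
rewrite /circ_free (eq_pick (Q := fun j => (a + j \notin C) &&
  [forall i : 'I_k.+1, (i < j)%N ==> (a + i \in C)])).
  by case: pickP => // j _; rewrite addrAC.
move=> j /=; rewrite addrAC inE'; congr (_ && _); apply: eq_forallb => i.
by rewrite addrAC inE'.
Qed.

Lemma circ_unl_shift (k : nat) (C : {set 'I_k.+1}) (c : 'I_k.+1) (s : seq 'I_k.+1) :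
  circ_unl [set r + c | r in C] [seq r + c | r <- s] = circ_unl C s.
Proof.
elim: s C => //= a s IHs C; rewrite circ_free_shift -IHs imsetU1.
by rewrite (mem_imset _ _ (addIr c)).
Qed.

(** * Weighted enumeration of words on the circle *)

Lemma big_cons_tuple (R : nmodType) (T : finType) (d : nat) (F : seq T -> R) :
  \sum_(t : d.+1.-tuple T) F t = \sum_(a : T) \sum_(t : d.-tuple T) F (a :: t).
Proof.
rewrite pair_big /= (reindex (fun p : T * d.-tuple T => [tuple of p.1 :: p.2])) //.
exists (fun t : d.+1.-tuple T => (thead t, [tuple of behead t])) => [[a t]|t] _ /=.
  by congr (_, _); apply: val_inj.
by rewrite [RHS]tuple_eta.
Qed.

(** Induction on the word. Wherever the first car parks, the occupied set gains one spot, so the sum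
    over the rest depends only on [#|C|] and factors out. *)
Lemma sum_circ_weight (R : comNzRingType) (x y : R) (k d : nat) (C : {set 'I_k.+1}) :
  0 \in C -> (#|C| + d <= k.+2)%N ->
  \sum_(t : d.-tuple 'I_k.+1) x ^+ circ_unl C t * y ^+ count_mem 0 t =
  \prod_(#|C| <= i < #|C| + d) (x * y + (i%:R - 1) * x + (k.+1%:R - i%:R)).
Proof.
elim: d C => [|d IHd] C C0 leC.
  rewrite addn0 big_geq // (eq_bigr (fun=> 1)) => [|t _].
    by rewrite sumr_const card_tuple expn0.
  by rewrite tuple0 /= !expr0 mulr1.
rewrite addnS big_ltn ?ltnS ?leq_addr //.
rewrite (big_cons_tuple _ (fun t : seq 'I_k.+1 => x ^+ circ_unl C t * y ^+ count_mem 0 t)).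
set P := \prod_(_ <= _ < _) _.
have leC1 : (#|C| <= k.+1)%N by have := max_card C; rewrite card_ord.
rewrite (eq_bigr (fun a => x ^+ (a \in C) * y ^+ (a == 0) * P)) => [|a _]; last first.
  have <- : \sum_(t : d.-tuple 'I_k.+1) x ^+ circ_unl (circ_free C a |: C) t *
      y ^+ count_mem 0 t = P.
    (* Only the last car can meet a full circle; the occupied set then fails to grow, but no letter
       remains. *)
    rewrite {}/P; case: d => [|d] in IHd leC *.
      rewrite addn0 big_geq // (eq_bigr (fun=> 1)) => [|t _].
        by rewrite sumr_const card_tuple expn0.
      by rewrite tuple0 /= !expr0 mulr1.
    have fC : circ_free C a \notin C by apply: circ_free_notin; lia.
    rewrite IHd ?cardsU1 ?fC ?add1n ?addSn ?inE ?C0 ?orbT //; lia.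
  by rewrite mulr_sumr; apply: eq_bigr => t _ /=; rewrite !exprD; ring.
rewrite -mulr_suml; congr (_ * _).
(* The letter 0 gives [x * y], each of the other [#|C| - 1] occupied spots gives [x], and each free
   spot gives 1. *)
rewrite (bigID (mem C)) /= (bigD1 0) //= C0 ?eqxx /= !expr1 -addrA.
rewrite (eq_bigr (fun=> x)) => [|a /andP[-> /negbTE->]]; last by rewrite mulr1.
rewrite (eq_bigr (P := fun a => a \notin C) (fun=> 1)) => [|a aC]; last first.
  by rewrite (negbTE aC) (_ : a == 0 = false) ?mulr1 //; apply: contraNF aC => /eqP->.
rewrite !sumr_const.
have -> : #|[pred a in C | a != 0]| = #|C|.-1.
  by rewrite (cardsD1 0 C) C0 /=; apply: eq_card => a; rewrite !inE andbC.
have -> : #|[pred a | a \notin C]| = (k.+1 - #|C|)%N.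
  have := cardC C; rewrite card_ord => /(canRL (addKn _)) <-.
  by apply: eq_card => a; rewrite !inE.
have C_gt0 : (0 < #|C|)%N by apply/card_gt0P; exists 0.
rewrite natrB // -[x *+ _]mulr_natl -subn1 natrB //; ring.
Qed.

(** * The cycle lemma for prime words *)

(* The residue r stands for spot r + 1. *)
Definition prime_word (k : nat) (s : seq 'I_k.+1) : bool :=
  [forall j : 'I_k.+1, j.+1 < count (fun r : 'I_k.+1 => r < j.+1) s]%N.

Definition visits (k : nat) (s : seq 'I_k.+1) (i : nat) : nat :=
  \sum_(0 <= l < i) count_mem (inZp l) s.

(** With m = [k.+1] and n = [k.+2], this is P(i) minus its mean growth n i / m, scaled by m to stay
    an integer. As n = m + 1, it is congruent to - i modulo m. *)
Definition balance (k : nat) (s : seq 'I_k.+1) (i : nat) : int :=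
  (k.+1 * visits s i)%:Z - (k.+2 * i)%:Z.

Lemma inZpD (k i j : nat) : inZp (i + j) = inZp i + inZp j :> 'I_k.+1.
Proof. by apply: val_inj; rewrite /= modnDm. Qed.

(** Subtracting i from all entries moves the starting point of the count to 0; within one turn no
    residue is met twice. *)
Lemma visitsD (k : nat) (s : seq 'I_k.+1) (i j : nat) :
  (j <= k.+1)%N ->
  visits s (i + j) =
  (visits s i + count (fun r : 'I_k.+1 => r < j) [seq (r - inZp i)%R | r <- s])%N.
Proof.
elim: j => [|j IHj] lej; first by rewrite addn0 (eq_count (a2 := pred0)) ?count_pred0 ?addn0.
rewrite addnS /visits big_nat_recr //= -/(visits s (i + j)) IHj; last exact: ltnW.
rewrite -addnA !count_map; congr (_ + _)%N.
elim: s {IHj} => //= r s; rewrite addnACA => ->; congr (_ + _)%N.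
have -> : (r == inZp (i + j)) = (r - inZp i == j :> nat).
  rewrite addnC inZpD -subr_eq -val_eqE.
  by rewrite [val (inZp j)]modn_small.
rewrite -[((r + _) %% _)%N]/(nat_of_ord (r - inZp i)) ltnS.
by case: ltngtP.
Qed.

Lemma visits_period (k : nat) (s : seq 'I_k.+1) (i : nat) :
  visits s (i + k.+1) = (visits s i + size s)%N.
Proof.
rewrite visitsD //; congr (_ + _)%N; rewrite -(size_map (fun r => r - inZp i) s).
by apply/eqP; rewrite -all_count; apply/allP => r _; exact: ltn_ord.
Qed.

Lemma balance_modn (k : nat) (s : seq 'I_k.+1) (i : nat) :
  size s = k.+2 -> balance s (i %% k.+1) = balance s i.
Proof.
move=> size_s; rewrite {2}(divn_eq i k.+1) addnC.
elim: (i %/ k.+1)%N => [|q IHq]; first by rewrite addn0.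
rewrite mulSn (addnC k.+1) addnA {}IHq /balance visits_period size_s; lia.
Qed.

(** If c entries lie in the d spots starting at i, the balance grows by m c - (m + 1) d. For 1 <= d
    <= m this is nonnegative exactly when c >= d + 1, since 0 < d / m <= 1. *)
Lemma prime_word_shift (k : nat) (s : seq 'I_k.+1) (i : nat) :
  size s = k.+2 ->
  reflect (forall j : nat, balance s i <= balance s j)
          (prime_word [seq r - inZp i | r <- s]).
Proof.
move=> size_s; apply: (iffP forallP) => [good j | minQ j].
  pose d : 'I_k.+1 := inZp j - inZp i.
  have <- : balance s (i + d) = balance s j.
    have /(congr1 val)/= E : inZp (i + d) = inZp j :> 'I_k.+1.
      by rewrite inZpD valZpK addrC subrK.
    by rewrite -(balance_modn _ size_s) E balance_modn.
  case: d => -[|d] ltd /=; first by rewrite addn0.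
  have := good (Ordinal (ltnW ltd)); rewrite /balance visitsD ?(ltnW ltd) //=.
  set c := count _ _; nia.
have := minQ (i + j.+1)%N; rewrite /balance visitsD //=.
have := ltn_ord j; set c := count _ _; nia.
Qed.

Lemma prime_word_shift_exists (k : nat) (s : seq 'I_k.+1) :
  size s = k.+2 -> exists c, prime_word [seq r + c | r <- s].
Proof.
move=> size_s.
case: (arg_minP (i0 := ord0 : 'I_k.+1) (P := predT) (fun i => balance s i)) => // i _ mini.
exists (- inZp i); apply/prime_word_shift => // j.
by rewrite -(balance_modn j) //; exact: (mini (inZp j)).
Qed.

(** Both 0 and - c minimise the balance, so the two values agree, and injectivity modulo m gives c =
    0. *)
Lemma prime_word_shift_inj (k : nat) (s : seq 'I_k.+1) (c : 'I_k.+1) :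
  size s = k.+2 -> prime_word s -> prime_word [seq r + c | r <- s] -> c = 0.
Proof.
move=> size_s good0 goodc.
have /prime_word_shift min0 : prime_word [seq r - inZp 0 | r <- s].
  by rewrite (_ : inZp 0 = 0) ?(eq_map (fun r => subr0 r)) ?map_id //; apply: val_inj.
have /prime_word_shift minc : prime_word [seq r - inZp (- c) | r <- s].
  by rewrite valZpK opprK.
have /eqP : balance s 0 == balance s (- c)%R by rewrite eq_le min0 // minc.
rewrite /balance /visits big_geq // => E.
apply/eqP; rewrite -oppr_eq0; apply/eqP/val_inj; rewrite [RHS]/=.
rewrite -[val _]/(nat_of_ord (- c)).
have := ltn_ord (- c); move: E; set v := \sum_(_ <= _ < _) _; set b := nat_of_ord _.
(* The equation says m (v - b) = b with 0 <= b < m, which leaves only b = 0. *)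
by case: (leqP v b) => vb E ltb; nia.
Qed.

(** * Parking on the line agrees with parking on the circle *)

Lemma first_freeE (n : nat) (occ : seq nat) (a t : nat) :
  (a <= t <= n)%N -> t \notin occ -> (forall i, (a <= i < t)%N -> i \in occ) ->
  first_free n occ a = Some t.
Proof.
move=> /andP[le_at le_tn] tocc ltocc; rewrite /first_free.
rewrite (_ : (n.+1 - a = (t - a) + (n - t).+1)%N); last by lia.
rewrite iotaD filter_cat (eq_in_filter (a2 := pred0)) => [|i]; last first.
  rewrite mem_iota => lei; apply/negbTE; rewrite negbK; apply: ltocc; lia.
by rewrite filter_pred0 subnKC //= tocc.
Qed.

Lemma first_free_pref (n : nat) (occ : seq nat) (a : nat) :
  (a <= n)%N -> (first_free n occ a != Some a) = (a \in occ).
Proof.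
move=> le_an; have [aocc|aocc] := boolP (a \in occ); last first.
  by rewrite (@first_freeE _ _ _ a) ?eqxx ?leqnn // => i; lia.
apply/eqP; rewrite /first_free; case E: filter => [|b l] //= [eq_ba].
have : a \in b :: l by rewrite eq_ba mem_head.
by rewrite -E mem_filter aocc.
Qed.

Lemma circ_free_nowrap (k : nat) (C : {set 'I_k.+1}) (a b : 'I_k.+1) :
  (a <= b)%N -> b \notin C -> (forall i : 'I_k.+1, (a <= i < b)%N -> i \in C) ->
  circ_free C a = b.
Proof.
move=> le_ab bC ltC.
have ab : a + (b - a) = b by rewrite addrC subrK.
have val_ba : nat_of_ord (b - a) = (b - a)%N.
  have -> : b - a = inZp (b - a)%N.
    by apply/eqP; rewrite subr_eq -[X in _ == _ + X]valZpK -inZpD subnK // valZpK.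
  by rewrite /= modn_small //; have := ltn_ord b; lia.
rewrite (@circ_freeE _ _ _ (b - a)) ?ab // => i; rewrite val_ba => lti.
by apply: ltC => /=; rewrite modn_small; have := ltn_ord b; lia.
Qed.

(* If every spot from [a] on were occupied, let [j] be the last free spot: the
   cars parked after [j], and the car preferring [a], all prefer spots after [j],
   and too few cars are left for the primality condition at [j]. *)
Lemma free_spot_after (k : nat) (v w : seq 'I_k.+1) (a : 'I_k.+1) (C : {set 'I_k.+1}) :
  size (v ++ a :: w) = k.+2 -> prime_word (v ++ a :: w) -> (0 < size w)%N ->
  #|C| = size v ->
  (forall j : 'I_k.+1, j \notin C ->
     #|[set r in C | (j < r)%N]| <= count (fun r : 'I_k.+1 => j < r) v)%N ->
  exists2 b : 'I_k.+1, (a <= b)%N & b \notin C.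
Proof.
rewrite size_cat /= => size_s /forallP prime_s w_gt0 cardC leC.
have [b Pb|noP] := pickP (fun b : 'I_k.+1 => (a <= b)%N && (b \notin C)).
  by exists b; case/andP: Pb.
(* The cars of [w] have yet to park, so at most k of the k + 1 spots are taken and some spot is
   free. *)
have fC : circ_free C a \notin C by apply: circ_free_notin; rewrite cardC; lia.
case: (@arg_maxnP _ (circ_free C a) (fun j => j \notin C) val fC) => j jC maxj.
have lt_ja : (j < a)%N by move: (noP j) => /=; rewrite jC andbT ltnNge => ->.
have := leC j jC; have := prime_s j.
have -> : [set r in C | (j < r)%N] = [set r : 'I_k.+1 | (j < r)%N].
  apply/setP=> r; rewrite !inE andb_idl // => ltr; apply: contraLR ltr.
  by move=> /maxj; rewrite -leqNgt.
have -> : #|[set r : 'I_k.+1 | (j < r)%N]| = (k - j)%N.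
  rewrite cardsE cardE size_filter -enumT -(count_map val (ltn j)) val_enum_ord.
  have lejk : (j <= k)%N by rewrite -ltnS ltn_ord.
  rewrite -[X in iota 0 X.+1](subnKC lejk) -addSn iotaD count_cat.
  rewrite (eq_in_count (a2 := pred0)) => [|i]; last first.
    by rewrite mem_iota /= ltnNge; lia.
  rewrite count_pred0 (eq_in_count (a2 := predT)) => [|i]; last first.
    by rewrite mem_iota /= add0n; lia.
  by rewrite count_predT size_iota.
have cnt_le u : (count (fun r : 'I_k.+1 => r < j.+1) u +
    count (fun r : 'I_k.+1 => j < r) u = size u)%N.
  rewrite -(count_predC (fun r : 'I_k.+1 => (r < j.+1)%N) u); congr (_ + _)%N.
  by apply: eq_count => r /=; rewrite ltnNge -ltnS.
have := cnt_le v; have := cnt_le w; rewrite count_cat /=.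
by rewrite [(a < _)%N]ltnNge lt_ja /= => *; exfalso; lia.
Qed.

(** Induction on the cars [w] still to come, those of [v] being parked. The last hypothesis is the
    invariant that no parked car has passed a spot that is still free. *)
Lemma count_unlucky_circ (k : nat) (w v : seq 'I_k.+1) (occ : seq nat) (C : {set 'I_k.+1}) :
  size (v ++ w) = k.+2 -> prime_word (v ++ w) ->
  (forall r : 'I_k.+1, (r \in C) = (r.+1 \in occ)) -> #|C| = size v ->
  (forall j : 'I_k.+1, j \notin C ->
     #|[set r in C | (j < r)%N]| <= count (fun r : 'I_k.+1 => j < r) v)%N ->
  count (fun p : option nat * nat => p.1 != Some p.2)
    (zip (park k.+2 occ [seq (nat_of_ord r).+1 | r <- w]) [seq (nat_of_ord r).+1 | r <- w])
  = circ_unl C w.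
Proof.
elim: w v occ C => //= a w IHw v occ C size_s prime_s occC cardC leC.
rewrite first_free_pref -?occC; last by have := ltn_ord a; lia.
(* Where the last car ends up is irrelevant: only whether its preference is occupied is counted. So
   line and circle need to agree only for the earlier cars. *)
congr (_ + _)%N; case: w => [|a' w] in IHw size_s prime_s * => //.
have [b0 ab0 b0C] := free_spot_after size_s prime_s isT cardC leC.
have Pb0 : (a <= b0)%N && (b0 \notin C) by rewrite ab0.
(* The first free spot [b] from [a] on is chosen by both rules, without wrapping. *)
case: (@arg_minnP _ b0 (fun b : 'I_k.+1 => (a <= b)%N && (b \notin C)) val Pb0).
move=> b /andP[ab bC] minb.
have inC (i : 'I_k.+1) : (a <= i < b)%N -> i \in C.
  case/andP=> ai ib; apply: contraLR ib => iC.
  by rewrite -leqNgt; apply: minb; rewrite ai.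
rewrite (@first_freeE _ _ _ b.+1) -?occC //.
- rewrite (circ_free_nowrap ab bC inC); apply: (IHw (rcons v a)); rewrite ?cat_rcons //.
  + by move=> r; rewrite !inE eqSS occC.
  + by rewrite cardsU1 bC cardC size_rcons.
  move=> j; rewrite !inE negb_or => /andP[jb jC].
  rewrite -cats1 count_cat /= addn0 addnC.
  (* A spot [j] still free lies outside [a, b], so [j < b] forces [j < a]: the new car preserves the
     invariant. *)
  apply: leq_trans (_ : (j < b) + #|[set r in C | (j < r)%N]| <= _)%N; last first.
    apply: leq_add; last exact: leC.
    have [|aj] := ltnP j a; have [jb'|] := ltnP j b => //.
    by move: jC; rewrite inC // aj jb'.
  have [jb'|jb'] := ltnP j b.
    apply: leq_trans (_ : #|b |: [set r in C | (j < r)%N]| <= _)%N.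
      by apply/subset_leq_card/subsetP=> r; rewrite !inE; case: eqP.
    by rewrite cardsU1 leq_add2r leq_b1.
  apply/subset_leq_card/subsetP=> r; rewrite !inE => /andP[/orP[/eqP->|->->//]].
  by rewrite ltnNge jb'.
- by have := ltn_ord b; lia.
move=> [|i] /andP[ai ib] //.
have ltik : (i < k.+1)%N by have := ltn_ord b; lia.
by rewrite -(occC (Ordinal ltik)) inC //=; lia.
Qed.

Lemma unl_circ (k : nat) (s : seq 'I_k.+1) :
  size s = k.+2 -> prime_word s ->
  unl [seq (nat_of_ord r).+1 | r <- s] = circ_unl set0 s.
Proof.
move=> size_s prime_s; rewrite /unl size_map size_s.
apply: (@count_unlucky_circ _ _ [::]) => //=; first by move=> r; rewrite !inE.
  by rewrite cards0.
by move=> j _; rewrite leqn0 cards_eq0; apply/eqP/setP=> r; rewrite !inE.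
Qed.

(** * Prime parking functions as prime words *)

Lemma is_ppf_succ (k : nat) (s : seq 'I_k.+1) :
  size s = k.+2 -> is_ppf [seq (nat_of_ord r).+1 | r <- s] = prime_word s.
Proof.
move=> size_s; set s' := map _ _.
have size_s' : size s' = k.+2 by rewrite size_map.
have countE j : count (fun a => a <= j)%N s' = count (fun r : 'I_k.+1 => r < j)%N s.
  by rewrite count_map; apply: eq_count.
rewrite /is_ppf size_s' [_.-1]/=; apply/idP/forallP => [/andP[_ /allP prime_s] j | prime_s].
  by rewrite -countE; apply: prime_s; rewrite mem_iota; have := ltn_ord j; lia.
have lt_count j : (0 < j <= k.+1)%N -> (j < count (fun a => a <= j) s')%N.
  case: j => // j lejk; have ltjk : (j < k.+1)%N by [].
  by rewrite countE; exact: (prime_s (Ordinal ltjk)).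
apply/andP; split; last by apply/allP=> j; rewrite mem_iota => ltj; apply: lt_count; lia.
apply/andP; split; first by apply/allP=> a /mapP[r _ ->].
apply/allP=> i; rewrite mem_iota size_s' => lei.
(* For i <= k + 1, more than i entries are at most i, which bounds the i-th smallest. For i = k + 2
   it suffices that every entry is at most k + 1. *)
have [le_ik|lt_ki] := leqP i k.+1.
  rewrite -leEnat; apply: nth_count_le; first exact: (sort_sorted leq_total).
  have -> : count (<= i)%O (sort leq s') = count (fun a => a <= i)%N s'.
    by rewrite count_sort.
  have := lt_count i; lia.
have : nth 0%N (sort leq s') i.-1 \in s'.
  by rewrite -(mem_sort leq) mem_nth // size_sort size_s'; lia.
case/mapP=> r _ ->; have := ltn_ord r; lia.
Qed.

(** Primality at j = n - 1 requires n entries at most n - 1, that is, all of them. *)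
Lemma ppf_bounds (k : nat) (s : seq nat) (a : nat) :
  size s = k.+2 -> is_ppf s -> a \in s -> (0 < a <= k.+1)%N.
Proof.
move=> size_s /andP[/andP[/allP s_gt0 _] /allP prime_s] as_; rewrite s_gt0 //=.
have : (k.+1 \in iota 1 (size s).-1) by rewrite mem_iota size_s; lia.
move=> /prime_s; rewrite -size_s leqNgt => cnt.
suff /allP : all (fun a => a <= k.+1)%N s by exact.
by rewrite all_count eqn_leq count_size leqNgt.
Qed.

Lemma sum_PPF (R : nmodType) (k : nat) (F : seq nat -> R) :
  \sum_(p in PPF k.+2) F (entries p) =
  \sum_(t : k.+2.-tuple 'I_k.+1 | prime_word t) F [seq (nat_of_ord r).+1 | r <- t].
Proof.
pose up (t : k.+2.-tuple 'I_k.+1) : k.+2.-tuple 'I_k.+3 :=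
  [tuple of [seq inord (nat_of_ord r).+1 | r <- t]].
pose down (p : k.+2.-tuple 'I_k.+3) : k.+2.-tuple 'I_k.+1 :=
  [tuple of [seq inord (nat_of_ord a).-1 | a <- p]].
have entries_up t : entries (up t) = [seq (nat_of_ord r).+1 | r <- t].
  rewrite /entries -map_comp; apply: eq_map => r /=.
  by rewrite inordK //; have := ltn_ord r; lia.
rewrite (reindex_onto up down) => [|p]; last first.
  rewrite inE => ppf_p; apply/val_inj; rewrite /= -map_comp -[RHS]map_id.
  apply/eq_in_map => a ap /=.
  (* [down] is undone by [up] only for entries between 1 and k + 1, as primality ensures. *)
  have : nat_of_ord a \in entries p by apply: map_f.
  move=> /(ppf_bounds _ ppf_p); rewrite size_map size_tuple => /(_ _ erefl) lea.
  by apply: val_inj; rewrite /= !inordK; lia.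
apply: eq_big => [t|t _]; last by rewrite entries_up.
rewrite inE entries_up is_ppf_succ ?size_tuple // andb_idr // => _.
apply/eqP/val_inj; rewrite /= -map_comp -[RHS]map_id; apply: eq_map => r /=.
by have ltr := ltn_ord r; apply: val_inj; rewrite /= !inordK; lia.
Qed.

(** * From prime words to words starting with 0, and the product formula *)

(* Every shift class contains exactly one prime word and exactly one word
   starting with 0. *)
Lemma sum_prime_word (R : nmodType) (k : nat) (F : seq 'I_k.+1 -> R) :
  (forall c s, F [seq r + c | r <- s] = F s) ->
  \sum_(t : k.+2.-tuple 'I_k.+1 | prime_word t) F t =
  \sum_(t : k.+1.-tuple 'I_k.+1) F (0 :: t).
Proof.
move=> F_shift.
pose shift c (t : k.+2.-tuple 'I_k.+1) := [tuple of [seq r + c | r <- t]].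
(* The word starting with 0 in the shift class of [t]. *)
pose root t := shift (- thead t) t.
have root_inj : {in [pred t : k.+2.-tuple 'I_k.+1 | prime_word t] &, injective root}.
  move=> t u; rewrite !inE => prime_t prime_u eq_root.
  have [c u_shift] : exists c, u = shift c t.
    exists (thead u - thead t); apply/val_inj; rewrite /= addrC.
    have /(congr1 (map (fun r => r + thead u))) := congr1 val eq_root.
    rewrite /= -!map_comp [RHS](eq_map (g := id)) ?map_id => [<-|r]; last exact: subrK.
    by apply: eq_map => r; exact/esym/addrA.
  move: prime_u; rewrite u_shift => /(prime_word_shift_inj (size_tuple t) prime_t) ->.
  apply/val_inj; rewrite /= (eq_map (g := id)) ?map_id // => r.
  exact: addr0.
rewrite (eq_bigr (fun t => F (root t))) => [|t _]; last by rewrite F_shift.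
rewrite -(big_imset (fun t : k.+2.-tuple 'I_k.+1 => F t) root_inj) /=.
rewrite (reindex_onto (fun t : k.+1.-tuple 'I_k.+1 => [tuple of 0 :: t])
  (fun t => [tuple of behead t])) => [|t]; last first.
  case/imsetP=> u _ ->; apply: val_inj; rewrite /= [u]tuple_eta /= theadE subrr //.
apply: eq_bigl => t; apply/andP; split; last by apply/eqP/val_inj.
(* Surjectivity: some shift of [0 :: t] by c is prime; its first entry is c, so its root is [0 :: t]
   again. *)
have [|c prime_c] := @prime_word_shift_exists k [tuple of 0 :: t]; first exact: size_tuple.
apply/imsetP; exists (shift c [tuple of 0 :: t]) => //.
have head_c : thead (shift c [tuple of 0 :: t]) = c.
  by rewrite /thead (tnth_nth 0) [LHS]add0r.
rewrite /root head_c; apply: val_inj; rewrite /= add0r subrr -map_comp.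
rewrite (eq_map (g := id)) ?map_id // => r.
exact: addrK.
Qed.

Theorem theorem5p4 (R : comNzRingType) (n : nat) (x y : R) (hn : (1 <= n)%N) :
  \sum_(p in PPF n) x ^+ unl (entries p) * y ^+ lel (entries p) =
  y * \prod_(1 <= i < n) (x * y + (i%:R - 1) * x + (n%:R - 1 - i%:R)).
Proof.
(* The case n = 1 is separate, since a circle of n - 1 spots would be empty. *)
case: n hn => [//|[|k]] _.
  rewrite big_geq // mulr1 (big_pred1 [tuple ord_max]) => [|p].
    by rewrite /= expr0 mul1r expr1.
  case/tupleP: p => a t; rewrite tuple0 inE [RHS]/= -val_eqE /= eqseq_cons andbT -val_eqE /=.
  by case: a => -[|[|]].
rewrite (sum_PPF _ (fun s => x ^+ unl s * y ^+ lel s)).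
(* Counting the letters equal to the head, not to 0, makes the weight shift invariant. *)
pose W (s : seq 'I_k.+1) := x ^+ circ_unl set0 s * y ^+ count_mem (head 0 s) s.
rewrite (eq_bigr (fun t => W (val t))) => [|t prime_t]; last first.
  rewrite unl_circ ?size_tuple // /W; congr (_ * _ ^+ _).
  rewrite [t]tuple_eta /lel /= count_map; rewrite !eqxx; congr (_ + _)%N.
rewrite sum_prime_word => [|c s]; last first.
  rewrite /W -{1}(imset0 (fun r => r + c)) circ_unl_shift; congr (_ * _ ^+ _).
  case: s => //= a s; rewrite count_map !eqxx; congr (_ + _)%N.
  by apply: eq_count => r /=; rewrite (inj_eq (addIr c)).
(* The first car takes spot 0 and is lucky: it contributes the factor [y] and leaves [[set 0]]
   occupied. *)
have circ0 : circ_free set0 (0 : 'I_k.+1) = 0.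
  by apply: circ_free_nowrap; rewrite ?inE // => i; lia.
rewrite (eq_bigr (fun t : k.+1.-tuple 'I_k.+1 =>
    y * (x ^+ circ_unl [set 0] t * y ^+ count_mem 0 t))) => [|t _]; last first.
  by rewrite /W /= inE circ0 setU0 add0n ?eqxx exprD expr1 mulrCA.
rewrite -mulr_sumr sum_circ_weight ?inE // cards1 //; congr (_ * _).
by rewrite add1n; apply: eq_bigr => i _; congr (_ + (_ - _)); rewrite -[k.+2]addn1 natrD addrK.
Qed.
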